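(* For $N\in\{2,3,4\}$ let $G_N=\mathrm{SL}(2,\mathbb Z/N\mathbb Z)$, and define functions $\varepsilon_N$ on $G_N$ by $$\varepsilon_2(A)=e^{\frac{2\pi i}{2}(\mathrm t(A)+1)\{A\}_2},\quad \varepsilon_3(A)=e^{\frac{2\pi i}{3}\mathrm t(A)\{A\}_3},\quad \varepsilon_4(A)=s(A)\,e^{\frac{2\pi i}{4}(\mathrm t(A)+1)\{A\}_4}.$$ Then, for each $N\in\{2,3,4\}$, the function $\varepsilon_N$ is a linear character of $G_N$ of order $N$, and it generates the group of linear characters of $G_N$.
   Context: A linear character of a group is a group homomorphism into the multiplicative group of complex numbers of modulus $1$; linear characters form a group under pointwise multiplication. $\mathrm t(A)$ denotes the trace of $A$. For $A=\begin{bmatrix}*&b\\c&*\end{bmatrix}\in G_N$ the quantity $\{A\}_N\in\mathbb Z/N\mathbb Z$ is defined by: $\{A\}_N=0$ if $A=\pm1$, or if $N=4$ and $A\equiv 1\bmod 2$; $\{A\}_N=1$ if $\mathrm t(A)^2\neq 4$ in $\mathbb Z/N\mathbb Z$; and in all other cases $\{A\}_N=c$ if $c$ is a unit of $\mathbb Z/N\mathbb Z$ and $\{A\}_N=-b$ otherwise. For $A\in G_4$, $s(A)=-1$ if $A$ can be written in the form $1+2\begin{bmatrix}a&b\\c&*\end{bmatrix}$ with $a+b+c$ odd, and $s(A)=1$ otherwise. *)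

(* Defs.v *)
From HB Require Import structures.
From mathcomp Require Import all_boot all_order all_algebra all_fingroup.
From mathcomp Require Import all_classical all_reals all_analysis.
From mathcomp Require Import complex.

Set Implicit Arguments.
Unset Strict Implicit.
Unset Printing Implicit Defensive.

Import Order.TTheory GRing.Theory Num.Theory.

Local Open Scope ring_scope.

Record SL2 (R : comUnitRingType) := MkSL2 {
  SL2val :> 'M[R]_2;
  SL2valP : \det SL2val == 1
}.

HB.instance Definition _ (R : comUnitRingType) := [isSub for @SL2val R].
HB.instance Definition _ (R : comUnitRingType) := [Choice of SL2 R by <:].

Section SL2Group.
Variable R : comUnitRingType.
Implicit Types A B C : SL2 R.

Lemma SL2_unitmx A : (A : 'M[R]_2) \in unitmx.
Proof. by rewrite unitmxE (eqP (SL2valP A)) unitr1. Qed.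

Lemma SL2_one_subproof : \det (1%:M : 'M[R]_2) == 1.
Proof. by rewrite det1. Qed.
Definition SL2_one : SL2 R := MkSL2 SL2_one_subproof.

Lemma SL2_mul_subproof A B : \det (A *m B) == 1.
Proof. by rewrite det_mulmx (eqP (SL2valP A)) (eqP (SL2valP B)) mulr1. Qed.
Definition SL2_mul A B : SL2 R := MkSL2 (SL2_mul_subproof A B).

Lemma SL2_inv_subproof A : \det (invmx A) == 1.
Proof. by rewrite det_inv (eqP (SL2valP A)) invr1. Qed.
Definition SL2_inv A : SL2 R := MkSL2 (SL2_inv_subproof A).

Lemma SL2_mulA : associative SL2_mul.
Proof. by move=> A B C; apply: val_inj; exact: mulmxA. Qed.

Lemma SL2_mul1 : left_id SL2_one SL2_mul.
Proof. by move=> A; apply: val_inj; exact: mul1mx. Qed.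

Lemma SL2_mulr1 : right_id SL2_one SL2_mul.
Proof. by move=> A; apply: val_inj; exact: mulmx1. Qed.

Lemma SL2_mulV : left_inverse SL2_one SL2_inv SL2_mul.
Proof. by move=> A; apply: val_inj; exact: mulVmx (SL2_unitmx A). Qed.

Lemma SL2_mulrV : right_inverse SL2_one SL2_inv SL2_mul.
Proof. by move=> A; apply: val_inj; exact: mulmxV (SL2_unitmx A). Qed.

HB.instance Definition _ := isGroup.Build (SL2 R)
  SL2_mulA SL2_mul1 SL2_mulr1 SL2_mulV SL2_mulrV.
End SL2Group.

HB.instance Definition _ (R : finComUnitRingType) :=
  [Countable of SL2 R by <:].
HB.instance Definition _ (R : finComUnitRingType) := [Finite of SL2 R by <:].

Record lin_char (R : realType) (G : groupType) := LinChar {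
  lin_char_fun :> G -> R[i];
  lin_charM : forall x y : G,
    lin_char_fun (x * y)%g = lin_char_fun x * lin_char_fun y;
  lin_char_norm : forall x : G, `|lin_char_fun x| = 1
}.

HB.instance Definition _ (R : realType) (G : groupType) :=
  gen_eqMixin (lin_char R G).
HB.instance Definition _ (R : realType) (G : groupType) :=
  gen_choiceMixin (lin_char R G).

Section LinCharGroup.
Variables (R : realType) (G : groupType).
Implicit Types phi chi psi : lin_char R G.

Lemma lin_charP phi chi : phi =1 chi -> phi = chi.
Proof.
case: phi chi => [f fM fN] [g gM gN] /= /funext fg; subst g.
by rewrite (Prop_irrelevance fM gM) (Prop_irrelevance fN gN).
Qed.

Lemma lin_char_neq0 phi x : phi x != 0.
Proof. by rewrite -normr_eq0 lin_char_norm oner_neq0. Qed.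

Definition lin_char_one : lin_char R G.
Proof.
apply: (@LinChar R G (fun=> 1)) => [x y|x]; first by rewrite mulr1.
exact: normr1.
Defined.

Definition lin_char_mul phi chi : lin_char R G.
Proof.
apply: (@LinChar R G (fun x => phi x * chi x)) => [x y|x].
  by rewrite !lin_charM mulrACA.
by rewrite normrM !lin_char_norm mulr1.
Defined.

Definition lin_char_inv phi : lin_char R G.
Proof.
apply: (@LinChar R G (fun x => (phi x)^-1)) => [x y|x].
  by rewrite lin_charM invfM.
by rewrite normfV lin_char_norm invr1.
Defined.

Lemma lin_char_mulA : associative lin_char_mul.
Proof. by move=> phi chi psi; apply: lin_charP => x; exact: mulrA. Qed.

Lemma lin_char_mulC : commutative lin_char_mul.
Proof. by move=> phi chi; apply: lin_charP => x; exact: mulrC. Qed.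

Lemma lin_char_mul1 : left_id lin_char_one lin_char_mul.
Proof. by move=> phi; apply: lin_charP => x; exact: mul1r. Qed.

Lemma lin_char_mulr1 : right_id lin_char_one lin_char_mul.
Proof. by move=> phi; rewrite lin_char_mulC lin_char_mul1. Qed.

Lemma lin_char_mulV : left_inverse lin_char_one lin_char_inv lin_char_mul.
Proof.
by move=> phi; apply: lin_charP => x; exact: mulVf (lin_char_neq0 phi x).
Qed.

Lemma lin_char_mulrV : right_inverse lin_char_one lin_char_inv lin_char_mul.
Proof. by move=> phi; rewrite lin_char_mulC lin_char_mulV. Qed.

HB.instance Definition _ := isGroup.Build (lin_char R G)
  lin_char_mulA lin_char_mul1 lin_char_mulr1 lin_char_mulV lin_char_mulrV.
End LinCharGroup.

(* The library's #[x] and <[x]> require a finite group. *)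
Definition has_order (G : groupType) (x : G) (n : nat) : Prop :=
  [/\ (0 < n)%N, (x ^+ n = 1)%g
    & forall m : nat, (0 < m < n)%N -> (x ^+ m <> 1)%g].

Definition generates (G : groupType) (x : G) : Prop :=
  forall y : G, exists n : nat, (y = x ^+ n)%g \/ (y = x ^- n)%g.

Definition cexp (R : realType) (z : R[i]) : R[i] :=
  let: (a +i* b)%C := z in (expR a)%:C%C * (cos b +i* sin b)%C.

(* e^(2 pi i x / N); the representative 0 <= x < N chosen by the coercion
   'Z_N >-> nat is irrelevant by periodicity. *)
Definition eZ (R : realType) (N : nat) (x : 'Z_N) : R[i] :=
  cexp (2 * (pi : R)%:C%C * 'i%C / N%:R * (x : nat)%:R).

(* {A}_N. The congruence modulo 2 is tested on representatives, which makes
   sense because it is only used for N = 4. *)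
Definition brace (N : nat) (A : SL2 'Z_N) : 'Z_N :=
  let M : 'M['Z_N]_2 := A in
  let b := M 0 1 in
  let c := M 1 0 in
  if [|| M == 1, M == -1
       | (N == 4%N) &&
          [forall i, forall j, (M i j == (i == j) %[mod 2])%N]] then 0
  else if (\tr M) ^+ 2 != 4 then 1
  else if c \is a GRing.unit then c
  else - b.

(* The parity of an element of Z/4Z is that of any of its representatives. *)
Definition sgn4 (R : realType) (A : SL2 'Z_4) : R[i] :=
  if [exists X : 'M['Z_4]_2,
        ((A : 'M['Z_4]_2) == 1 + 2 *: X) &&
        odd (X 0 0 + X 0 1 + X 1 0)%R]
  then -1 else 1.

Definition eps2 (R : realType) (A : SL2 'Z_2) : R[i] :=
  eZ R ((\tr A + 1) * brace A).

Definition eps3 (R : realType) (A : SL2 'Z_3) : R[i] :=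
  eZ R (\tr A * brace A).

Definition eps4 (R : realType) (A : SL2 'Z_4) : R[i] :=
  sgn4 R A * eZ R ((\tr A + 1) * brace A).

Definition generating_lin_char (R : realType) (G : groupType)
    (f : G -> R[i]) (n : nat) : Prop :=
  exists chi : lin_char R G,
    [/\ (chi : G -> R[i]) = f, has_order chi n & generates chi].

(* Main.v *)
(** The matrix [upper 1] generates SL(2, Z/N) up to commutators: Weyl
    conjugation gives [chi (lower x) = chi (upper (- x))], and for the local
    ring Z/N the Bruhat decomposition applies to A or to [A * lower 1]. A linear
    character is therefore determined by its value at [upper 1], which is an
    N-th root of unity. The three functions have the form [A |-> e(g A / N)]
    with g valued in Z/N and [g (upper 1) = 1]; that g is additive is a finite
    computation on matrix entries. *)

Require Import Defs.
From mathcomp Require Import all_boot all_algebra all_reals.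
From mathcomp Require Import all_order boolp trigo exp.
From mathcomp Require Import complex ring lra.

Set Implicit Arguments.
Unset Strict Implicit.
Unset Printing Implicit Defensive.

Import Order.TTheory GRing.Theory Num.Theory.
Local Open Scope ring_scope.

(** * Roots of unity and the exponential [eZ] *)

Section RootsOfUnity.
Variable R : realType.

Definition cis (t : R) : R[i] := (cos t +i* sin t)%C.

Lemma cisD s t : cis (s + t) = cis s * cis t.
Proof. by rewrite /cis cosD sinD; simpc; congr (_ +i* _)%C; ring. Qed.

Lemma cis0 : cis 0 = 1.
Proof. by rewrite /cis cos0 sin0. Qed.

Lemma cisMn t n : cis (t *+ n) = cis t ^+ n.
Proof.
elim: n => [|n IHn]; first by rewrite mulr0n expr0 cis0.
by rewrite mulrS cisD IHn exprS.
Qed.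

(** By the half-angle formula, [cos t = 1] forces [sin (t / 2) = 0], while [t / 2] lies strictly
    between 0 and [pi]. *)
Lemma cis_eq1 t : 0 < t < 2 * pi -> cis t != 1.
Proof.
move=> /andP[t0 t2pi]; apply/eqP => -[cost _].
have := sin_gt0_pi (x := t / 2); have := cos2sin2 (t / 2).
have := cos_mulr2n (t / 2); have -> : (t / 2) *+ 2 = t by lra.
rewrite cost => c2 cs; have -> : 0 < t / 2 < pi by lra.
by move=> /(_ isT); nra.
Qed.

Definition zeta (N : nat) : R[i] := cis (2 * pi / N%:R).

Lemma zeta_prim N : (1 < N)%N -> N.-primitive_root (zeta N).
Proof.
move=> N1; have N0 : (0 < N)%N by apply: ltnW.
have NR0 : N%:R != 0 :> R by rewrite pnatr_eq0 -lt0n.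
have zN : zeta N ^+ N = 1.
  rewrite -cisMn -[_ *+ N]mulr_natr divfK// mulr_natl.
  by rewrite /cis cos2pi sin2pi.
have [m mprim mN] := prim_order_exists N0 zN.
move: (mN) mprim; have := dvdn_leq N0 mN; rewrite leq_eqVlt.
case/orP => [/eqP-> //|mltN _ mprim].
have m0 := prim_order_gt0 mprim.
(* For [m < N] the angle [2 * pi * m / N] lies strictly between 0 and [2 * pi]. *)
have /eqP[] : zeta N ^+ m != 1; last exact: prim_expr_order.
rewrite -cisMn; apply: cis_eq1.
have pi0 : 0 < 2 * pi :> R by rewrite mulr_gt0 ?pi_gt0.
rewrite -[_ *+ m]mulr_natr -mulrA pmulr_rgt0// gtr_pMr// mulrC.
by rewrite divr_gt0 ?ltr0n//= ltr_pdivrMr ?ltr0n// mul1r ltr_nat.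
Qed.

Lemma norm_zeta N : `|zeta N| = 1.
Proof. by rewrite /zeta /cis normc_def /= cos2Dsin2 sqrtr1. Qed.

Lemma eZE N (x : 'Z_N) : eZ R x = zeta N ^+ x.
Proof.
rewrite /zeta -cisMn /eZ.
have -> : 2 * (pi : R)%:C%C * 'i%C / N%:R * (x : nat)%:R =
  (0 +i* ((2 * pi / N%:R) *+ x))%C :> R[i].
  have natC n : n%:R = (n%:R : R)%:C%C :> R[i] by rewrite rmorph_nat.
  rewrite !natC -fmorphV; simpc; congr (_ +i* _)%C; rewrite -mulr_natr.
  by ring.
by rewrite /cexp expR0 mul1r.
Qed.

Lemma eZD N (x y : 'Z_N) : (1 < N)%N -> eZ R (x + y) = eZ R x * eZ R y.
Proof.
(* After the case split the modulus of ['Z_N] is N itself, and [zeta N ^+ N = 1] absorbs the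
   reduction of the sum. *)
move=> N1; rewrite !eZE -exprD; case: N N1 x y => [|[|N]]// N1 x y.
exact/expr_mod/prim_expr_order/zeta_prim.
Qed.

Lemma eZ1 N : (1 < N)%N -> eZ R (1 : 'Z_N) = zeta N.
Proof. by move=> N1; rewrite eZE /= modn_small ?expr1// Zp_cast. Qed.

End RootsOfUnity.

(** * Elementary matrices and the Bruhat decomposition *)

Section ElementaryMatrices.
Variable K : comUnitRingType.
Implicit Types A B : SL2 K.

Lemma det_mx2 (M : 'M[K]_2) : \det M = M 0 0 * M 1 1 - M 0 1 * M 1 0.
Proof.
rewrite (expand_det_row _ 0) !big_ord_recl big_ord0 /cofactor !det_mx11 !mxE.
rewrite addr0 expr0 expr1 mul1r mulN1r mulrN.
by congr (M _ _ * M _ _ - M _ _ * M _ _); apply: val_inj.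
Qed.

Lemma tr_mx2 (M : 'M[K]_2) : \tr M = M 0 0 + M 1 1.
Proof.
rewrite /mxtrace !big_ord_recl big_ord0 addr0.
by congr (M _ _ + M _ _); apply: val_inj.
Qed.

Lemma mul_mx2 (M P : 'M[K]_2) i j :
  (M *m P) i j = M i 0 * P 0 j + M i 1 * P 1 j.
Proof.
rewrite mxE !big_ord_recl big_ord0 addr0.
by congr (M _ _ * P _ _ + M _ _ * P _ _); apply: val_inj.
Qed.

Lemma ord2P (i : 'I_2) : i = 0 \/ i = 1.
Proof. by case: i => [[|[|//]] lti]; [left|right]; apply: val_inj. Qed.

Lemma eq_mx2P (M P : 'M[K]_2) :
  reflect [/\ M 0 0 = P 0 0, M 0 1 = P 0 1, M 1 0 = P 1 0 & M 1 1 = P 1 1]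
          (M == P).
Proof.
apply: (iffP eqP) => [->//|[e00 e01 e10 e11]].
by apply/matrixP => i j; case: (ord2P i) => ->; case: (ord2P j) => ->.
Qed.

Definition mx2 (a b c d : K) : 'M[K]_2 :=
  \matrix_(i, j) if i == 0 then if j == 0 then a else b
                 else if j == 0 then c else d.

Lemma upper_subproof x : \det (mx2 1 x 0 1) == 1.
Proof. by rewrite det_mx2 !mxE /= mulr0 subr0 mulr1. Qed.
Definition upper x : SL2 K := MkSL2 (upper_subproof x).

Lemma lower_subproof x : \det (mx2 1 0 x 1) == 1.
Proof. by rewrite det_mx2 !mxE /= mul0r subr0 mulr1. Qed.
Definition lower x : SL2 K := MkSL2 (lower_subproof x).

Lemma weyl_subproof : \det (mx2 0 (-1) 1 0) == 1.
Proof. by rewrite det_mx2 !mxE /= mul0r sub0r mulr1 opprK. Qed.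
Definition weyl : SL2 K := MkSL2 weyl_subproof.

Lemma SL2_eqP A B :
  reflect [/\ A 0 0 = B 0 0, A 0 1 = B 0 1, A 1 0 = B 1 0 & A 1 1 = B 1 1]
          (A == B).
Proof. by rewrite -(inj_eq val_inj); exact: eq_mx2P. Qed.

Lemma SL2_mulE A B i j : (A * B)%g i j = A i 0 * B 0 j + A i 1 * B 1 j.
Proof. exact: mul_mx2. Qed.

Lemma SL2_det A : A 0 0 * A 1 1 - A 0 1 * A 1 0 = 1.
Proof. by rewrite -det_mx2; exact/eqP/SL2valP. Qed.

Lemma upperD x y : upper (x + y) = (upper x * upper y)%g.
Proof. by apply/eqP/SL2_eqP; split; rewrite !SL2_mulE !mxE /=; ring. Qed.

Lemma weyl_upper x : (weyl * upper x = lower (- x) * weyl)%g.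
Proof. by apply/eqP/SL2_eqP; split; rewrite !SL2_mulE !mxE /=; ring. Qed.

(** The diagonal entries force the two outer factors; the determinant then gives the upper right
    entry. *)
Lemma bruhat A : A 1 0 \is a GRing.unit ->
  A = (upper ((A 0 0 - 1) / A 1 0)%R * lower (A 1 0)%R
         * upper ((A 1 1 - 1) / A 1 0)%R)%g.
Proof.
move=> cU; have dA := SL2_det A; have uc := mulVr cU.
apply/eqP/SL2_eqP; split; rewrite !SL2_mulE !mxE /=;
  move: (A 0 0) (A 0 1) (A 1 0) (A 1 1) (A 1 0)^-1 dA uc => a b c d u dA uc.
(* The nontrivial differences of entries are combinations of [1 - u * c] and [1 - (a * d - b * c)],
   both zero. *)
- apply/subr0_eq; transitivity ((a - 1) * (1 - u * c)); first by ring.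
  by rewrite uc subrr mulr0.
- apply/subr0_eq.
  transitivity ((b + (a - 1) * (d - 1) * u) * (1 - u * c)
                + u * (1 - (a * d - b * c))); first by ring.
  by rewrite uc dA subrr !mulr0 addr0.
- by ring.
- apply/subr0_eq; transitivity ((d - 1) * (1 - u * c)); first by ring.
  by rewrite uc subrr mulr0.
Qed.

Lemma mul_lower1 A : (A * lower 1%R)%g 1 0 = A 1 0 + A 1 1.
Proof. by rewrite SL2_mulE !mxE /= !mulr1. Qed.

Lemma lower_mulN x : (lower x * lower (- x) = 1)%g.
Proof. by apply/eqP/SL2_eqP; split; rewrite !SL2_mulE !mxE /=; ring. Qed.

End ElementaryMatrices.

(** * Reduction of character values to upper unipotent matrices *)

Section CharactersOfSL2.
Variables (R : realType) (K : comUnitRingType).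
Implicit Types (chi : lin_char R (SL2 K)) (A : SL2 K).

Lemma lin_char1 chi : chi 1%g = 1.
Proof.
apply: (mulfI (lin_char_neq0 chi 1%g)).
by rewrite -lin_charM mulg1 mulr1.
Qed.

Lemma lin_char_lower chi x : chi (lower x) = chi (upper (- x)).
Proof.
apply: (mulIf (lin_char_neq0 chi (weyl K))).
by rewrite -lin_charM -[x]opprK -weyl_upper opprK lin_charM mulrC.
Qed.

Lemma lin_char_upperMn chi x n : chi (upper (x *+ n)) = chi (upper x) ^+ n.
Proof.
elim: n => [|n IHn]; last by rewrite mulrS upperD lin_charM IHn exprS.
have -> : upper 0 = 1%g :> SL2 K; last exact: lin_char1.
by apply/eqP/SL2_eqP; split; rewrite !mxE.
Qed.

(** The witness depends on A alone, so the same [x] serves to compare any two characters. *)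
Lemma lin_char_upper A :
    (A 1 0 \is a GRing.unit) || (A 1 0 + A 1 1 \is a GRing.unit) ->
  exists x, forall chi, chi A = chi (upper x).
Proof.
have unit_case (B : SL2 K) : B 1 0 \is a GRing.unit ->
    exists x, forall chi, chi B = chi (upper x).
  move=> cU; exists ((B 0 0 - 1) / B 1 0 - B 1 0 + (B 1 1 - 1) / B 1 0) => chi.
  by rewrite {1}(bruhat cU) !lin_charM lin_char_lower -!lin_charM -!upperD.
case/orP => [/unit_case//|]; rewrite -mul_lower1 => /unit_case[x chiE].
(* Undoing [lower 1] costs a factor [lower (- 1)], where [chi] takes the value [chi (upper 1)]. *)
exists (x + 1) => chi.
rewrite -[A]mulg1 -(lower_mulN 1) mulgA lin_charM chiE lin_char_lower opprK.
by rewrite -lin_charM -upperD.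
Qed.

End CharactersOfSL2.

(** * The group of linear characters of SL(2, Z/N) *)

Section CharacterGroup.
Variables (R : realType) (N : nat).
Hypothesis N1 : (1 < N)%N.
(** True over a local ring: the entries of the bottom row are not both in the maximal ideal, so if
    the first is, the sum is not. *)
Hypothesis N_local : forall A : SL2 'Z_N,
  (A 1 0 \is a GRing.unit) || (A 1 0 + A 1 1 \is a GRing.unit).
Implicit Types (chi psi : lin_char R (SL2 'Z_N)) (A : SL2 'Z_N).

Lemma lin_charX chi n A : (chi ^+ n)%g A = chi A ^+ n.
Proof. by elim: n => // n IHn; rewrite expgS exprS -IHn. Qed.

(** Every [upper x] is a power of [upper 1], because 1 generates Z/N additively. *)
Lemma lin_char_ext chi psi : chi (upper 1) = psi (upper 1) -> chi = psi.
Proof.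
move=> chi1; apply: lin_charP => A; have [x E] := lin_char_upper R (N_local A).
by rewrite !E -[x]natr_Zp !lin_char_upperMn chi1.
Qed.

Lemma eZ_generating (f : SL2 'Z_N -> 'Z_N) :
    {morph f : A B / (A * B)%g >-> A + B} -> f (upper 1) = 1 ->
  generating_lin_char (fun A => eZ R (f A)) N.
Proof.
move=> fM f1; have zP := zeta_prim R N1.
have norm1 A : `|eZ R (f A)| = 1.
  by rewrite eZE normrX norm_zeta expr1n.
pose chi := @LinChar R (SL2 'Z_N) (fun A => eZ R (f A))
  (fun A B => etrans (congr1 _ (fM A B)) (eZD R (f A) (f B) N1)) norm1.
have chi1 : chi (upper 1) = zeta R N by rewrite /= f1 eZ1.
exists chi; split=> //.
  (* The order of [chi] is that of its value [zeta N] at [upper 1]. *)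
  split=> [||m /andP[m0 mN]
      /(congr1 (fun psi : lin_char R _ => psi (upper 1)))].
  - exact: ltnW.
  - by apply: lin_char_ext; rewrite lin_charX chi1 prim_expr_order.
  rewrite lin_charX chi1 /= => /eqP; rewrite -(prim_order_dvd zP).
  by rewrite gtnNdvd.
(* Since N = 0 in Z/N, [psi (upper 1)] is an N-th root of unity, hence a power of the primitive root
   [chi (upper 1)]. *)
move=> psi; have psiN : psi (upper 1) ^+ N = 1.
  rewrite -lin_char_upperMn -[1 *+ N]/(N%:R) pchar_Zp//.
  by rewrite -(mulr0n 1) lin_char_upperMn.
have [i psi1] := prim_rootP zP psiN; exists i; left.
by apply: lin_char_ext; rewrite lin_charX chi1.
Qed.

End CharacterGroup.

(** * Reduction to finite computations on matrix entries *)

Section Entrywise.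
Variable N : nat.

(** An explicit list, so that [all4] evaluates under [vm_compute]. *)
Definition Zseq : seq 'Z_N := [seq inZp i | i <- iota 0 (Zp_trunc N).+2].

Lemma mem_Zseq (x : 'Z_N) : x \in Zseq.
Proof. by rewrite -[x]valZpK map_f// mem_iota add0n ltn_ord. Qed.

Definition all4 (P : 'Z_N -> 'Z_N -> 'Z_N -> 'Z_N -> bool) : bool :=
  all (fun a => all (fun b => all (fun c => all (P a b c) Zseq) Zseq) Zseq) Zseq.

Lemma all4P P : all4 P -> forall a b c d, P a b c d.
Proof.
move=> allP4 a b c d; move: allP4.
move=> /allP/(_ a (mem_Zseq a))/allP/(_ b (mem_Zseq b)).
by move=> /allP/(_ c (mem_Zseq c))/allP/(_ d (mem_Zseq d)).
Qed.

(** A matrix-free form of [brace], suited to evaluation. *)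
Definition braceE (a b c d : 'Z_N) : 'Z_N :=
  if [|| [&& a == 1, b == 0, c == 0 & d == 1],
         [&& a == -1, b == 0, c == 0 & d == -1]
       | (N == 4%N) && [&& odd a, ~~ odd b, ~~ odd c & odd d]] then 0
  else if (a + d) ^+ 2 != 4 then 1
  else if c \is a GRing.unit then c
  else - b.

Lemma brace_entries (A : SL2 'Z_N) :
  brace A = braceE (A 0 0) (A 0 1) (A 1 0) (A 1 1).
Proof.
rewrite /brace /braceE tr_mx2; congr (if _ then _ else _).
congr [|| _, _ | _ && _].
- by apply/eq_mx2P/and4P => -[]; rewrite !mxE => *; split; exact/eqP.
- by apply/eq_mx2P/and4P => -[]; rewrite !mxE ?oppr0 => *; split; exact/eqP.
apply/idP/and4P.
  have odd_entry i j : (A i j == (i == j) %[mod 2])%N -> odd (A i j) = (i == j).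
    by rewrite !modn2; case: odd; case: (i == j).
  move=> /forallP oddA.
  by split; rewrite odd_entry//; apply: (forallP (oddA _)).
case=> o00 o01 o10 o11.
apply/forallP => i; apply/forallP => j; rewrite !modn2.
case: (ord2P i) => ->; case: (ord2P j) => -> /=;
  by rewrite ?o00 ?o11 ?(negPf o01) ?(negPf o10).
Qed.

(* [if] rather than [==>] keeps [vm_compute] from evaluating the conclusion on
   matrices of determinant other than 1. *)
Definition additive_check (g : 'Z_N -> 'Z_N -> 'Z_N -> 'Z_N -> 'Z_N) :=
  all4 (fun a b c d => if a * d - b * c == 1 then
    all4 (fun a' b' c' d' => if a' * d' - b' * c' == 1 then
      g (a * a' + b * c') (a * b' + b * d') (c * a' + d * c') (c * b' + d * d')
        == g a b c d + g a' b' c' d'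
      else true) else true).

Definition of_entries (g : 'Z_N -> 'Z_N -> 'Z_N -> 'Z_N -> 'Z_N)
    (A : SL2 'Z_N) := g (A 0 0) (A 0 1) (A 1 0) (A 1 1).

Lemma additive_checkP g : additive_check g ->
  {morph of_entries g : A B / (A * B)%g >-> A + B}.
Proof.
move=> gP A B; have := all4P gP (A 0 0) (A 0 1) (A 1 0) (A 1 1).
rewrite SL2_det eqxx => /all4P/(_ (B 0 0) (B 0 1) (B 1 0) (B 1 1)).
by rewrite SL2_det eqxx /of_entries !SL2_mulE => /eqP.
Qed.

Definition local_check :=
  all4 (fun a b c d => if a * d - b * c == 1 then
      (c \is a GRing.unit) || (c + d \is a GRing.unit) else true).

Lemma local_checkP (A : SL2 'Z_N) : local_check ->
  (A 1 0 \is a GRing.unit) || (A 1 0 + A 1 1 \is a GRing.unit).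
Proof.
by move=> /all4P/(_ (A 0 0) (A 0 1) (A 1 0) (A 1 1)); rewrite SL2_det eqxx.
Qed.

(** For concrete N and [g], all hypotheses but the last are closed computations; [g 1 1 0 1] is the
    value at [upper 1]. *)
Lemma generating_of_entries (R : realType) (f : SL2 'Z_N -> R[i]) g :
    (1 < N)%N -> local_check -> additive_check g -> g 1 1 0 1 = 1 ->
    (forall A, f A = eZ R (of_entries g A)) ->
  generating_lin_char f N.
Proof.
move=> N1 locN addg g1 /funext ->.
apply: eZ_generating => //; last by rewrite /of_entries !mxE.
  by move=> A; exact: local_checkP.
exact: additive_checkP.
Qed.

End Entrywise.

(** * Logarithms of the three functions *)

Definition eps2_log (a b c d : 'Z_2) := (a + d + 1) * braceE a b c d.
Definition eps3_log (a b c d : 'Z_3) := (a + d) * braceE a b c d.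
(* If A = 1 + 2 X then the entries of X are, modulo 2, the halves (rounded down)
   of those of A. *)
Definition sgn4E (a b c d : 'Z_4) : bool :=
  [&& odd a, ~~ odd b, ~~ odd c, odd d & odd (a./2 + b./2 + c./2)].
Definition eps4_log (a b c d : 'Z_4) : 'Z_4 :=
  (if sgn4E a b c d then 2 else 0) + (a + d + 1) * braceE a b c d.

Lemma mx_scale2E (N : nat) (X : 'M['Z_N]_2) i j :
  (1 + 2 *: X) i j = (i == j)%:R + 2 * X i j.
Proof. by rewrite !mxE. Qed.

(** Writing the sign -1 as [zeta R 4 ^+ 2] turns it into a summand 2 of the exponent. *)
Lemma sgn4_entries (R : realType) (A : SL2 'Z_4) :
  sgn4 R A =
    eZ R (if sgn4E (A 0 0) (A 0 1) (A 1 0) (A 1 1) then 2 else 0 : 'Z_4).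
Proof.
rewrite /sgn4.
rewrite (_ : [exists X, _] = sgn4E (A 0 0) (A 0 1) (A 1 0) (A 1 1)); last first.
  apply/existsP/idP => [[X /andP[/eqP-> oddX]]|].
    rewrite !mx_scale2E /=.
    (* Modulo 4, [2 *: X] determines X modulo 2, so the parity can be read off from A. *)
    have /all4P/(_ (X 0 0) (X 0 1) (X 1 0) (X 1 1)) :
        all4 (fun x y z w : 'Z_4 => odd (x + y + z)%R ==>
          sgn4E (1 + 2 * x) (0 + 2 * y) (0 + 2 * z) (1 + 2 * w)).
      by vm_compute.
    by rewrite oddX.
  move=> sgnA.
  (* Halving rounds down, which matches the 1 on the diagonal, where the entries are odd. *)
  exists (mx2 (A 0 0)./2%:R (A 0 1)./2%:R (A 1 0)./2%:R (A 1 1)./2%:R).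
  have /all4P/(_ (A 0 0) (A 0 1) (A 1 0) (A 1 1)) :
      all4 (fun a b c d : 'Z_4 => sgn4E a b c d ==>
        [&& a == 1 + 2 * a./2%:R, b == 0 + 2 * b./2%:R,
            c == 0 + 2 * c./2%:R, d == 1 + 2 * d./2%:R
          & odd (a./2%:R + b./2%:R + c./2%:R : 'Z_4)%R]).
    by vm_compute.
  rewrite sgnA => /and5P[/eqP e00 /eqP e01 /eqP e10 /eqP e11 oddX].
  apply/andP; split; last by rewrite !mxE.
  by apply/eq_mx2P; rewrite !mx_scale2E !mxE.
case: ifP => _; last by rewrite eZE expr0.
rewrite eZE; have zP := zeta_prim R (isT : 1 < 4)%N.
(* The square of [zeta R 4] is a square root of 1 other than 1, as 4 does not divide 2. *)
have : zeta R 4 ^+ 2 ^+ 2 == 1 by rewrite -exprM (prim_expr_order zP).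
by rewrite sqrf_eq1 -(prim_order_dvd zP) /= => /eqP ->.
Qed.

Theorem mainTheorem5 (R : realType) :
  [/\ generating_lin_char (eps2 R) 2,
      generating_lin_char (eps3 R) 3
    & generating_lin_char (eps4 R) 4].
Proof.
split.
- apply: (@generating_of_entries _ _ _ eps2_log) => [|||| A];
    only 1-3: by vm_compute.
  + by apply/val_inj; vm_compute.
  + by rewrite /eps2 tr_mx2 brace_entries.
- apply: (@generating_of_entries _ _ _ eps3_log) => [|||| A];
    only 1-3: by vm_compute.
  + by apply/val_inj; vm_compute.
  + by rewrite /eps3 tr_mx2 brace_entries.
- apply: (@generating_of_entries _ _ _ eps4_log) => [|||| A];
    only 1-3: by vm_compute.
  + by apply/val_inj; vm_compute.
  + by rewrite /eps4 tr_mx2 brace_entries sgn4_entries -eZD.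
Qed.
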